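(* Let $w=a^{\alpha_1}b^{\beta_1}a^{\alpha_2}b^{\beta_2}\cdots a^{\alpha_n}b^{\beta_n}$ with $n\ge 1$ and all $\alpha_i,\beta_i$ positive integers. Let $p/q$ be a reduced fraction ($q\ge1$, $\gcd(p,q)=1$) and $g=\gcd(q,h_a(w))$. Then $$\frac{h_b(w)}{h_a(w)}\le\sigma_w(g)\le\max_{1\le i\le n}\beta_i.$$ Moreover, $\sigma_w(g)=h_b(w)/h_a(w)$ when $h_a(w)$ divides $q$, and $\sigma_w(g)=\max_{1\le i\le n}\beta_i$ when $\gcd(q,h_a(w))=1$.
   Context: $\mathrm{Homeo}_+^\sim(S^1)$ is the group of orientation-preserving homeomorphisms of $\mathbb{R}$ commuting with the translation $x\mapsto x+1$. For $f\in \mathrm{Homeo}_+^\sim(S^1)$, the (real-valued) rotation number is $\mathrm{rot}^\sim(f)=\lim_{n\to\infty} f^n(0)/n\in\mathbb{R}$. $F$ is the free group on $a,b$. A word $w\in F$ is positive if it lies in the semigroup generated by $a$ and $b$ (only positive powers occur); $h_a(w)$ and $h_b(w)$ denote the numbers of $a$'s and $b$'s in $w$. For $r,s\in\mathbb{R}$, $R(w;r,s)$ is the maximum of $\mathrm{rot}^\sim(\rho(w))$ over all homomorphisms $\rho:F\to\mathrm{Homeo}_+^\sim(S^1)$ with $\mathrm{rot}^\sim(\rho(a))=r$ and $\mathrm{rot}^\sim(\rho(b))=s$ (the maximum is known to be attained). It is known (Calegari-Walker) that for $w$ positive and not a power of $a$ or $b$, and $r$ rational, there is a least rational number $s\in[0,1)$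 such that $R(w;r,t)=h_a(w)r+h_b(w)$ for all $t\in[s,1)$. The fringe length of $r$ is $\mathrm{fr}_w(r):=1-s$. For a reduced fraction $p/q$, the quantity $1/(q\cdot\mathrm{fr}_w(p/q))$ depends only on $w$ and on $g=\gcd(q,h_a(w))$ (the Fringe Formula), and $\sigma_w(g)$ denotes this quantity, so that $\mathrm{fr}_w(p/q)=\frac{1}{\sigma_w(g)\,q}$. *)

(* Defs.v *)
From mathcomp Require Import all_boot all_order all_algebra.
From mathcomp Require Import all_classical all_reals all_analysis.
Set Implicit Arguments.
Unset Strict Implicit.
Unset Printing Implicit Defensive.
Import Order.TTheory GRing.Theory Num.Theory numFieldNormedType.Exports.
Local Open Scope classical_set_scope.
Local Open Scope ring_scope.

Inductive letter := La | Lb.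

Definition is_a (l : letter) : bool := if l is La then true else false.
Definition is_b (l : letter) : bool := ~~ is_a l.

(* Positive elements of the free group on a, b: the free monoid on the two
   letters embeds in the free group. *)
Definition pos_word := seq letter.

Definition h_a (w : pos_word) : nat := count is_a w.
Definition h_b (w : pos_word) : nat := count is_b w.

(* a^(alpha 0) b^(beta 0) ... a^(alpha (n-1)) b^(beta (n-1)) *)
Definition block_word (n : nat) (alpha beta : 'I_n -> nat) : pos_word :=
  flatten [seq nseq (alpha i) La ++ nseq (beta i) Lb | i <- enum 'I_n].

Section Rotation.
Context {R : realType}.
Implicit Types (f fa fb : R -> R) (w : pos_word) (r s t : R).

(* Membership in Homeo_+^~(S^1). *)
Definition homeo_tilde f : Prop :=
  [/\ continuous f,
      exists2 f' : R -> R, continuous f' & cancel f f' /\ cancel f' f,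
      {homo f : x y / x < y} &
      forall x : R, f (x + 1) = f x + 1].

Definition rot f : R := limn (fun n : nat => iter n f 0 / n%:R).

(* The value at w of the homomorphism rho with rho(a) = fa and rho(b) = fb; by
   freeness, homomorphisms from the free group are exactly the pairs (fa, fb).
   The product of the group of homeomorphisms is composition. *)
Definition word_map fa fb w : R -> R :=
  foldr (fun l f => (if is_a l then fa else fb) \o f) id w.

Definition rot_values w r s : set R :=
  [set x | exists fa fb, [/\ homeo_tilde fa, homeo_tilde fb,
     rot fa = r, rot fb = s & x = rot (word_map fa fb w)]].

(* R(w; r, s) = m. *)
Definition max_rot_is w r s (m : R) : Prop :=
  rot_values w r s m /\ ubound (rot_values w r s) m.

Definition fringe_start w r (s : rat) : Prop :=
  0 <= s < 1 /\
  forall t, ratr s <= t < 1 ->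
    max_rot_is w r t ((h_a w)%:R * r + (h_b w)%:R).

Definition least_fringe_start w r (s : rat) : Prop :=
  fringe_start w r s /\ forall s' : rat, fringe_start w r s' -> s <= s'.

(* xget picks the unique element of the set when there is one; the default
   value 1 is used only if there is no least s. *)
Definition fr w r : R := 1 - ratr (xget 1 [set s | least_fringe_start w r s]).

End Rotation.

(* The common value of 1 / (q fr_w(p/q)) over all reduced fractions p/q with
   gcd(q, h_a(w)) = g (default value 0 if there were no common value). *)
Definition sigma (R : realType) (w : pos_word) (g : nat) : R :=
  xget 0 [set x : R | forall (p : int) (q : nat),
    (0 < q)%N -> coprime `|p|%N q -> gcdn q (h_a w) = g ->
    x = 1 / (q%:R * fr w (p%:~R / q%:R))].

(* Main.v *)
Require Import Defs.
From mathcomp Require Import all_boot all_order all_algebra.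
From mathcomp Require Import all_classical all_reals all_analysis.
From mathcomp Require Import ring lra zify.
Import Order.TTheory GRing.Theory Num.Theory numFieldNormedType.Exports.
Local Open Scope ring_scope.
Set Implicit Arguments.
Unset Strict Implicit.

(** Why the theorem is true.

    If b has rotation number t < 1, it moves every point by less than 1, so
    [rot w <= h_a r + h_b] ([rot_word_le]). Equality with r = p / q forces a
    periodic point of w whose orbit loses nothing: write b = c + 1, so that c moves
    points strictly back, and let x_m be a periodic orbit of a, ordered along the
    line, with a x_m = x_(m + p). The map a preserves the partition of the line
    into the intervals between consecutive x_m, and c only moves back, so a
    periodic point can never cross an end of the interval it is in, other than
    by following a. Each power b^beta_j met after A_j letters a, in all
    repetitions of w, must therefore stay in its interval. The repetitions
    reach the intervals of a whole residue class modulo g = gcd(q, h_a), since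
    the multiples of h_a fill the multiples of g modulo q. With
    demand(k) = max { beta_j : A_j = k mod g }, the interval reached after k
    letters a thus has room for demand(k) steps of c, and one turn has room for

      S = (q / g) * (demand(0) + ... + demand(g - 1))

    steps, whence 1 - t <= 1 / S ([demand_necessary]).

    Conversely, when S (1 - t) <= 1 one lays out intervals along the line, the
    m-th with room for its demanded number of steps of a map b with rotation
    number t, and lets a be piecewise affine, permute the ends of the intervals
    and carry a point near the bottom of each interval to a point near the top
    of its image. Then w never falls behind ([demand_sufficient]). At
    t = 1 - 1 / S there is no slack and b cannot be a translation
    ([exists_fast_homeo]).

    Hence the fringe starts at 1 - 1 / S, and sigma(g) = S / q is the average of
    the demand over the residues modulo g ([sigma_formula]). An average of maxima
    of the beta_j is at most their maximum, which is the single term when g = 1.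
    The A_j are distinct elements of [0, h_a), which contains h_a / g
    representatives of each residue, so the sum h_b of the beta_j is at most
    h_a / g times the sum of the demands ([sum_demand_ge]); a maximum being at
    most a sum, the sum of the demands is at most h_b ([sum_demand_le]), and
    both bounds meet when g = h_a. *)

(** * Lifts of circle maps and their rotation numbers *)

Section Lifts.
Context {R : realType}.
Implicit Types (f fa fb : R -> R) (x y : R) (w : pos_word).

(** The properties of lifts of circle homeomorphisms that suffice for a rotation
    number; unlike membership in the group they need neither continuity nor an
    inverse, so they are immediate for words and iterates. *)
Definition circle_lift f := {homo f : x y / x <= y} /\ forall x, f (x + 1) = f x + 1.

Lemma lift_homeo f : homeo_tilde f -> circle_lift f.
Proof.
case=> _ _ fmono fD; split=> // x y; rewrite le_eqVlt => /predU1P[->//|/fmono].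
exact: ltW.
Qed.

Lemma lift_le f x y : circle_lift f -> x <= y -> f x <= f y.
Proof. by case=> h _; apply: h. Qed.

Lemma liftDn f x n : circle_lift f -> f (x + n%:R) = f x + n%:R.
Proof.
move=> [_ fD]; elim: n => [|n IH]; first by rewrite !addr0.
by rewrite -natr1 !addrA fD IH.
Qed.

Lemma liftBn f x n : circle_lift f -> f (x - n%:R) = f x - n%:R.
Proof. by move=> lf; rewrite -[in RHS](subrK n%:R x) liftDn // addrK. Qed.

Lemma liftDz f x (m : int) : circle_lift f -> f (x + m%:~R) = f x + m%:~R.
Proof.
move=> lf; case: m => n; first exact: liftDn.
by rewrite NegzE rmorphN /= -pmulrn liftBn.
Qed.

Lemma lift_comp f g : circle_lift f -> circle_lift g -> circle_lift (f \o g).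
Proof.
move=> [fm fD] [gm gD]; split=> [x y /gm/fm//|x].
by rewrite /= gD fD.
Qed.

Lemma lift_id : circle_lift id. Proof. by split. Qed.

Lemma lift_iter f n : circle_lift f -> circle_lift (iter n f).
Proof.
move=> lf; elim: n => [|n IH]; first exact: lift_id.
exact: (lift_comp lf IH).
Qed.

Lemma lift_word fa fb w : circle_lift fa -> circle_lift fb -> circle_lift (word_map fa fb w).
Proof.
move=> la lb; elim: w => [|l w IH]; first exact: lift_id.
by apply: lift_comp IH; case: l.
Qed.

Lemma iter_shift_ge f x c m n : circle_lift f -> x + c%:~R <= iter m f x ->
  x + (n%:R * c%:~R) <= iter (n * m) f x.
Proof.
move=> lf h; elim: n => [|n IH]; first by rewrite mul0r addr0.
rewrite mulSn iterD; apply: le_trans (lift_le (lift_iter m lf) IH).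
have -> : n%:R * c%:~R = (n%:Z * c)%:~R :> R by rewrite rmorphM.
rewrite liftDz; last exact: lift_iter.
rewrite rmorphM /= -natr1 mulrDl mul1r.
rewrite -pmulrn; lra.
Qed.

Lemma iter_shift_le f x c m n : circle_lift f -> iter m f x <= x + c%:~R ->
  iter (n * m) f x <= x + (n%:R * c%:~R).
Proof.
move=> lf h; elim: n => [|n IH]; first by rewrite mul0r addr0.
rewrite mulSn iterD; apply: le_trans (lift_le (lift_iter m lf) IH) _.
have -> : n%:R * c%:~R = (n%:Z * c)%:~R :> R by rewrite rmorphM.
rewrite liftDz; last exact: lift_iter.
rewrite rmorphM /= -natr1 mulrDl mul1r.
rewrite -pmulrn; lra.
Qed.

Lemma iter_shift f x c m n : circle_lift f -> iter m f x = x + c%:~R ->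
  iter (n * m) f x = x + n%:R * c%:~R.
Proof.
move=> lf h; apply/le_anti; rewrite iter_shift_le ?h //=.
by rewrite iter_shift_ge ?h.
Qed.

(** The displacement of a lift is almost constant: its value at 0 bounds
    it everywhere up to 1, which is what makes the growth rate independent of the
    base point. *)
Lemma lift_displacement f x : circle_lift f -> f 0 + x - 1 <= f x <= f 0 + x + 1.
Proof.
move=> lf; set m := Num.floor x.
have := floor_le x; have := floorD1_gt x; rewrite -/m => h1 h2.
have := lift_le lf h2; have := lift_le lf (ltW h1).
rewrite -[m%:~R]add0r -[(m + 1)%:~R]add0r !liftDz //.
move: h1; rewrite !rmorphD /= => *; lra.
Qed.

Lemma archi_le0 (x D : R) : (forall n : nat, n%:R * x <= D) -> x <= 0.
Proof.
move=> h; rewrite leNgt; apply/negP => x0.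
have D0 : 0 <= D by have := h 0; rewrite mul0r.
have := archi_boundP (divr_ge0 D0 (ltW x0)).
by rewrite ltr_pdivrMr // ltNge h.
Qed.

(** The approximations [(f^n 0 - 1) / n] and [(f^m 0 + 1) / m] are comparable
    through [f^(n m) 0], so their cut is filled by a real number. *)
Lemma lift_growth f : circle_lift f ->
  exists rho : R, forall n : nat, `|iter n f 0 - n%:R * rho| <= 1.
Proof.
move=> lf.
have hup m n : iter (n * m) f 0 <= n%:R * (iter m f 0 + 1) .
  elim: n => [|n IH]; first by rewrite mul0r.
  rewrite mulSn iterD.
  have /andP[_] := lift_displacement (iter (n * m) f 0) (lift_iter m lf).
  rewrite -natr1; lra.
have hlo m n : n%:R * (iter m f 0 - 1) <= iter (n * m) f 0.
  elim: n => [|n IH]; first by rewrite mul0r.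
  rewrite mulSn iterD.
  have /andP[] := lift_displacement (iter (n * m) f 0) (lift_iter m lf).
  rewrite -natr1; lra.
pose E := [set y | exists n, y = (iter n.+1 f 0 - 1) / n.+1%:R]%classic.
have Eub n : ubound E ((iter n.+1 f 0 + 1) / n.+1%:R).
  move=> _ [m ->]; rewrite ler_pdivrMr ?ltr0n // mulrAC ler_pdivlMr ?ltr0n //.
  rewrite mulrC [leRHS]mulrC (le_trans (hlo _ _)) // mulnC; exact: hup.
exists (sup E) => -[|n]; first by rewrite mul0r subrr normr0.
have n0 : 0 < n.+1%:R :> R by rewrite ltr0n.
have h1 : (iter n.+1 f 0 - 1) / n.+1%:R <= sup E.
  by apply: ub_le_sup; [exists ((iter 1 f 0 + 1) / 1%:R); exact: Eub | exists n].
have h2 : sup E <= (iter n.+1 f 0 + 1) / n.+1%:R.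
  by apply: ge_sup; [exists ((iter 1 f 0 - 1) / 1%:R); exists 0 | exact: Eub].
move: h1 h2; rewrite ler_pdivrMr // ler_pdivlMr // => h1 h2.
rewrite ler_norml; apply/andP; split; lra.
Qed.

Lemma rot_unique f (rho D : R) :
  (forall n : nat, `|iter n f 0 - n%:R * rho| <= D) -> Defs.rot f = rho.
Proof.
move=> h; apply/cvg_lim => //; apply/cvgrPdist_le => e e0.
have D0 : 0 <= D by apply: le_trans (h 0).
exists (Num.Def.archi_bound (D / e)).+1 => // n /= hn.
have n0 : 0 < n%:R :> R by rewrite ltr0n; apply: leq_trans hn.
have -> : rho - iter n f 0 / n%:R = - ((iter n f 0 - n%:R * rho) / n%:R).
  by field; rewrite gt_eqF.
rewrite normrN normrM normfV (gtr0_norm n0) ler_pdivrMr //.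
apply: le_trans (h n) _.
have := archi_boundP (divr_ge0 D0 (ltW e0)).
rewrite ltr_pdivrMr // => /ltW/le_trans; apply.
by rewrite mulrC ler_pM2l // ler_nat ltnW.
Qed.

Lemma rot_bound f n : circle_lift f -> `|iter n f 0 - n%:R * Defs.rot f| <= 1.
Proof. by move=> /lift_growth[rho h]; rewrite (rot_unique h). Qed.

(** One point moved by at least c in m steps is moved by at least n c in n m
    steps, so the bounded error in the growth estimate is divided by n. *)
Lemma rot_ge f x c m : circle_lift f -> x + c%:~R <= iter m f x ->
  c%:~R <= m%:R * Defs.rot f.
Proof.
move=> lf h; rewrite -subr_le0; apply: (@archi_le0 _ 2) => n.
have h1 := iter_shift_ge n lf h.
have := lift_displacement x (lift_iter (n * m) lf).
have := rot_bound (n * m) lf; rewrite natrM ler_norml => /andP[h2 h3] /andP[h4 h5].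
lra.
Qed.

Lemma rot_le f x c m : circle_lift f -> iter m f x <= x + c%:~R ->
  m%:R * Defs.rot f <= c%:~R.
Proof.
move=> lf h; rewrite -subr_le0; apply: (@archi_le0 _ 2) => n.
have h1 := iter_shift_le n lf h.
have := lift_displacement x (lift_iter (n * m) lf).
have := rot_bound (n * m) lf; rewrite natrM ler_norml => /andP[h2 h3] /andP[h4 h5].
lra.
Qed.

Lemma rot_periodic f x c m : circle_lift f -> iter m f x = x + c%:~R ->
  m%:R * Defs.rot f = c%:~R.
Proof.
move=> lf h; apply/le_anti/andP.
by split; [apply: (rot_le (x := x))|apply: (rot_ge (x := x))]; rewrite // h.
Qed.

Lemma rot_shift f (c : int) : circle_lift f ->
  Defs.rot (fun x => f x + c%:~R) = Defs.rot f + c%:~R.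
Proof.
move=> lf; apply: (@rot_unique _ _ 1) => n.
have -> : iter n (fun x => f x + c%:~R) 0 = iter n f 0 + n%:R * c%:~R.
  elim: n => [|n IH]; first by rewrite mul0r addr0.
  rewrite iterS IH.
  have -> : n%:R * c%:~R = (n%:Z * c)%:~R :> R by rewrite rmorphM.
  by rewrite liftDz // rmorphM /= -natr1 mulrDl mul1r addrA.
have := rot_bound n lf; congr (`|_| <= 1); lra.
Qed.

Lemma rot_translation (t : R) : Defs.rot (fun x => x + t) = t.
Proof.
apply: (@rot_unique _ _ 0) => n.
suff -> : iter n (fun x => x + t) 0 = n%:R * t by rewrite subrr normr0.
by elim: n => [|n IH]; rewrite ?mul0r // iterS IH -natr1 mulrDl mul1r.
Qed.

Lemma continuous_iter f n : continuous f -> continuous (iter n f).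
Proof.
move=> cf; elim: n => [|n IH] x; first exact: cvg_id.
exact: (continuous_comp (IH x) (cf _)).
Qed.

Lemma integer_translate01 x :
  exists2 y, 0 <= y <= 1 & exists c : int, x = y + c%:~R.
Proof.
exists (x - (Num.floor x)%:~R); last by exists (Num.floor x); rewrite subrK.
by have := floor_le x; have := floorD1_gt x; rewrite rmorphD /= => *; lra.
Qed.

(** Without a periodic point the continuous function [f^m x - x - c] has a
    constant sign, and compactness of a period bounds it away from 0, which
    moves the rotation number away from [c / m]. *)
Lemma rot_rational_periodic f (c : int) (m : nat) :
  circle_lift f -> continuous f -> (0 < m)%N -> m%:R * Defs.rot f = c%:~R ->
  exists x, iter m f x = x + c%:~R.
Proof.
move=> lf cf m0 hrot; have lfm := lift_iter m lf.
pose h x := iter m f x - x.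
have hper x (k : int) : h (x + k%:~R) = h x.
  by rewrite /h liftDz //; lra.
have hc : continuous h.
  by move=> x; apply: cvgB; [exact: continuous_iter | exact: cvg_id].
have hw (a b : R) : {within `[a, b], continuous h}%classic.
  exact: continuous_subspaceT.
have red x : exists2 y, y \in `[0, 1]%R & h x = h y.
  have [y y01 [k ->]] := integer_translate01 x.
  by exists y; [rewrite in_itv /= | rewrite hper].
have [x1 x1in hx1] := @EVT_min R h 0 1 ler01 (hw _ _).
have [x2 x2in hx2] := @EVT_max R h 0 1 ler01 (hw _ _).
have growth n : `|iter (n * m) f 0 - n%:R * c%:~R| <= 1.
  by have := rot_bound (n * m) lf; rewrite natrM -mulrA hrot.
have h1 : h x1 <= c%:~R.
  rewrite -subr_le0; apply: (@archi_le0 _ 1) => n.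
  have hn : n%:R * h x1 <= iter (n * m) f 0.
    elim: n => [|n IH]; first by rewrite mul0r.
    rewrite mulSn iterD -natr1 mulrDl mul1r.
    have [y yin hy] := red (iter (n * m) f 0).
    have := hx1 _ yin; rewrite -hy {2}/h; lra.
  have := growth n; rewrite ler_norml => /andP[*]; lra.
have h2 : c%:~R <= h x2.
  rewrite -subr_le0; apply: (@archi_le0 _ 1) => n.
  have hn : iter (n * m) f 0 <= n%:R * h x2.
    elim: n => [|n IH]; first by rewrite mul0r.
    rewrite mulSn iterD -natr1 mulrDl mul1r.
    have [y yin hy] := red (iter (n * m) f 0).
    have := hx2 _ yin; rewrite -hy {1}/h; lra.
  have := growth n; rewrite ler_norml => /andP[*]; lra.
(* The extreme displacements lie on both sides of c. *)
suff [x hx] : exists x, h x = c%:~R by exists x; rewrite -hx addrC subrK.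
have [x12|x21] := leP x1 x2.
  have [|x _ hx] := @IVT R h x1 x2 c%:~R x12 (hw _ _); last by exists x.
  by rewrite ge_min h1 le_max h2 orbT.
have [|x _ hx] := @IVT R h x2 x1 c%:~R (ltW x21) (hw _ _); last by exists x.
by rewrite ge_min h1 orbT le_max h2.
Qed.

End Lifts.

(** * Piecewise affine homeomorphisms *)

Section Homeos.
Context {R : realType}.
Implicit Types (f : R -> R) (Z : int -> R).

(** Monotonicity turns the preimages of [f x - e] and [f x + e] into a
    neighbourhood of x, so no modulus of continuity is needed. *)
Lemma increasing_bij_continuous f (f' : R -> R) :
  {homo f : x y / x < y} -> {homo f' : x y / x < y} -> cancel f f' -> cancel f' f ->
  continuous f.
Proof.
move=> fm f'm fK f'K x; apply/cvgrPdist_le => e e0.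
have h1 : f' (f x - e) < x by rewrite -[ltRHS]fK; apply: f'm; lra.
have h2 : x < f' (f x + e) by rewrite -[ltLHS]fK; apply: f'm; lra.
near=> z.
have z1 : f' (f x - e) < z by near: z; exact: lt_nbhsr.
have z2 : z < f' (f x + e) by near: z; exact: lt_nbhsl.
have := fm _ _ z1; have := fm _ _ z2; rewrite !f'K => *.
rewrite ler_norml; apply/andP; split; lra.
Unshelve. all: by end_near.
Qed.

Lemma homeo_of_increasing_bij f f' : {homo f : x y / x < y} ->
  (forall x, f (x + 1) = f x + 1) -> cancel f f' -> cancel f' f -> homeo_tilde f.
Proof.
move=> fm fD fK f'K.
have f'm : {homo f' : x y / x < y}.
  move=> x y xy; rewrite ltNge; apply/negP; rewrite le_eqVlt => /predU1P[e|/fm].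
    by move: xy; rewrite -(f'K x) -e f'K ltxx.
  by rewrite !f'K ltNge ltW.
split=> //; first exact: (increasing_bij_continuous fm f'm fK).
by exists f' => //; exact: (increasing_bij_continuous f'm fm f'K).
Qed.

Lemma homeo_translation (t : R) : homeo_tilde (fun x => x + t).
Proof.
apply: (@homeo_of_increasing_bij _ (fun x => x - t)).
- by move=> x y; rewrite ltrD2r.
- by move=> x; rewrite addrAC.
- by move=> x; rewrite addrK.
- by move=> x; rewrite subrK.
Qed.

Lemma homeo_add (c : R) f : homeo_tilde f -> homeo_tilde (fun x => f x + c).
Proof.
case=> fc [f' f'c [fK f'K]] fm fD.
apply: (@homeo_of_increasing_bij _ (fun x => f' (x - c))).
- by move=> x y /fm; rewrite ltrD2r.
- by move=> x; rewrite fD addrAC.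
- by move=> x; rewrite addrK fK.
- by move=> x; rewrite f'K subrK.
Qed.

(** The increasing enumeration by the integers of the preimage in the line of K
    points of the circle. *)
Definition lattice (K : nat) Z :=
  (forall m, Z m < Z (m + 1)) /\ (forall m, Z (m + K%:Z) = Z m + 1).

Lemma lattice_le K Z (m n : int) : lattice K Z -> m <= n -> Z m <= Z n.
Proof.
move=> [Zi _] mn; have -> : n = m + `|n - m|%N%:Z by lia.
elim: `|n - m|%N => [|k IH]; first by rewrite addr0.
apply: le_trans IH _; rewrite -addn1 PoszD addrA; exact: ltW.
Qed.

Lemma lattice_shift K Z (m k : int) : lattice K Z -> Z (m + k * K%:Z) = Z m + k%:~R.
Proof.
move=> [_ Zp].
have P (n : nat) i : Z (i + n%:Z * K%:Z) = Z i + n%:R.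
  elim: n => [|n IH]; first by rewrite mul0r !addr0.
  have -> : i + n.+1%:Z * K%:Z = i + n%:Z * K%:Z + K%:Z by lia.
  by rewrite Zp IH -natr1 addrA.
case: k => n; first exact: P.
rewrite NegzE rmorphN /= -pmulrn.
have := P n.+1 (m + - n.+1%:Z * K%:Z).
have -> : m + - n.+1%:Z * K%:Z + n.+1%:Z * K%:Z = m by lia.
by move=> ->; rewrite addrK.
Qed.

Lemma lattice_cell K Z (t : R) : lattice K Z -> exists m, Z m <= t < Z (m + 1).
Proof.
move=> ZL; set d := Num.floor (t - Z 0).
have := floor_le (t - Z 0); have := floorD1_gt (t - Z 0).
rewrite -/d => h1 h2.
have l1 : Z (d * K%:Z) <= t.
  have := lattice_shift 0 d ZL; rewrite add0r => ->; lra.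
have l2 : t < Z (d * K%:Z + K%:Z).
  have := lattice_shift 0 (d + 1) ZL; rewrite add0r mulrDl mul1r => ->; lra.
suff H (i : nat) : t < Z (d * K%:Z + i%:Z) -> exists m, Z m <= t < Z (m + 1).
  exact: H l2.
elim: i => [|i IH]; first by rewrite addr0 ltNge l1.
case: (ltP t (Z (d * K%:Z + i%:Z))) => [lt_i _|le_i hi]; first exact: IH.
exists (d * K%:Z + i%:Z); rewrite le_i /=.
by have -> : d * K%:Z + i%:Z + 1 = d * K%:Z + i.+1%:Z by lia.
Qed.

(** The piecewise affine interpolation between two lattices; xget selects the
    unique cell of Z that contains t. Exchanging Z and Z' gives the inverse. *)
Definition pw_affine Z Z' (t : R) : R :=
  let m := xget 0 [set m | Z m <= t < Z (m + 1)]%classic in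
  Z' m + (t - Z m) * (Z' (m + 1) - Z' m) / (Z (m + 1) - Z m).

Lemma pw_affineE K Z Z' t m : lattice K Z -> Z m <= t < Z (m + 1) ->
  pw_affine Z Z' t = Z' m + (t - Z m) * (Z' (m + 1) - Z' m) / (Z (m + 1) - Z m).
Proof.
move=> ZL /andP[h1 h2]; rewrite /pw_affine (@xget_unique _ _ _ m) //=; first by rewrite h1.
move=> m' /andP[h3 h4]; apply/le_anti/andP; split.
- rewrite -ltzD1 ltNge; apply/negP => /(lattice_le ZL); lra.
- rewrite -ltzD1 ltNge; apply/negP => /(lattice_le ZL); lra.
Qed.

Lemma pw_affine_cell K Z Z' t m : lattice K Z -> lattice K Z' -> Z m <= t < Z (m + 1) ->
  Z' m <= pw_affine Z Z' t < Z' (m + 1).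
Proof.
move=> ZL Z'L h; rewrite (pw_affineE Z' ZL h); case/andP: h => h1 h2.
have d0 : 0 < Z (m + 1) - Z m by rewrite subr_gt0; case: ZL.
have d'0 : 0 < Z' (m + 1) - Z' m by rewrite subr_gt0; case: Z'L.
apply/andP; split.
  by rewrite lerDl; apply: divr_ge0; [apply: mulr_ge0|]; lra.
rewrite -ltrBrDl ltr_pdivrMr // mulrC ltr_pM2l //; lra.
Qed.

Lemma pw_affineK K Z Z' : lattice K Z -> lattice K Z' -> cancel (pw_affine Z Z') (pw_affine Z' Z).
Proof.
move=> ZL Z'L t; have [m h] := lattice_cell t ZL.
rewrite (pw_affineE Z Z'L (pw_affine_cell ZL Z'L h)) (pw_affineE Z' ZL h).
have d0 : Z (m + 1) - Z m != 0 by rewrite gt_eqF // subr_gt0; case: ZL.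
have d'0 : Z' (m + 1) - Z' m != 0 by rewrite gt_eqF // subr_gt0; case: Z'L.
by field; apply/andP.
Qed.

Lemma pw_affine_homeo K Z Z' : lattice K Z -> lattice K Z' -> homeo_tilde (pw_affine Z Z').
Proof.
move=> ZL Z'L; apply: (homeo_of_increasing_bij _ _ (pw_affineK ZL Z'L) (pw_affineK Z'L ZL)).
- move=> s t st; have [m hm] := lattice_cell s ZL; have [n hn] := lattice_cell t ZL.
  case: (ltgtP m n) => mn.
  + have /andP[_ h1] := pw_affine_cell ZL Z'L hm; have /andP[h2 _] := pw_affine_cell ZL Z'L hn.
    apply: lt_le_trans h1 (le_trans _ h2); apply: (lattice_le Z'L).
    by rewrite addrC lez1D.
  + have : Z (n + 1) <= Z m by apply: (lattice_le ZL); rewrite addrC lez1D.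
    move: hm hn => /andP[? ?] /andP[? ?]; lra.
  + subst n; rewrite (pw_affineE Z' ZL hm) (pw_affineE Z' ZL hn) ltrD2l.
    have d0 : 0 < Z (m + 1) - Z m by rewrite subr_gt0; case: ZL.
    have d'0 : 0 < Z' (m + 1) - Z' m by rewrite subr_gt0; case: Z'L.
    by rewrite ltr_pM2r ?invr_gt0 // ltr_pM2r // ltrD2r.
- move=> t; have [m hm] := lattice_cell t ZL.
  have [_ Zp] := ZL; have [_ Z'p] := Z'L.
  have e : m + K%:Z + 1 = m + 1 + K%:Z by lia.
  have hm' : Z (m + K%:Z) <= t + 1 < Z (m + K%:Z + 1).
    by rewrite e !Zp lerD2r ltrD2r.
  rewrite (pw_affineE Z' ZL hm') (pw_affineE Z' ZL hm) e !Zp !Z'p.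
  have -> : t + 1 - (Z m + 1) = t - Z m by lra.
  have -> : Z' (m + 1) + 1 - (Z' m + 1) = Z' (m + 1) - Z' m by lra.
  have -> : Z (m + 1) + 1 - (Z m + 1) = Z (m + 1) - Z m by lra.
  lra.
Qed.

Lemma pw_affine_node K Z Z' m : lattice K Z -> pw_affine Z Z' (Z m) = Z' m.
Proof.
move=> ZL; rewrite (@pw_affineE K _ _ _ m) ?subrr ?mul0r ?addr0 // lexx.
by case: ZL => ->.
Qed.

Lemma lattice_extension (K : nat) (z : nat -> R) :
  (0 < K)%N -> (forall n, z n < z n.+1) -> (forall n, z (n + K)%N = z n + 1) ->
  exists2 Z, lattice K Z & forall n : nat, Z n%:Z = z n.
Proof.
move=> K0 zi zp.
have zs (j n : nat) : z (n + j * K)%N = z n + j%:R.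
  elim: j => [|j IH]; first by rewrite addn0 addr0.
  have -> : (n + j.+1 * K = n + j * K + K)%N by rewrite mulSn addnCA addnC.
  by rewrite zp IH -natr1 addrA.
(* Negative indices are reached from the natural ones by adding enough
   periods; by periodicity the number of periods does not matter. *)
pose up (m : int) (j : nat) : nat := absz (m + (j * K)%N%:Z).
pose Z (m : int) := z (up m (absz m)) - (absz m)%:R.
have ZE (m : int) (j : nat) : 0 <= m + (j * K)%N%:Z -> Z m = z (up m j) - j%:R.
  move=> mj; rewrite /Z; set i := absz m.
  have mi : 0 <= m + (i * K)%N%:Z by rewrite /i; nia.
  have := zs j (up m i); have := zs i (up m j).
  have -> : (up m i + j * K = up m j + i * K)%N by rewrite /up; lia.
  by move=> -> h; lra.
exists Z; last first.
  by move=> n; rewrite (ZE _ 0%N) /up ?mul0n ?addr0 ?subr0.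
split=> m.
- have h1 : 0 <= m + ((absz m).+1 * K)%N%:Z by nia.
  have h2 : 0 <= m + 1 + ((absz m).+1 * K)%N%:Z by nia.
  rewrite (ZE _ _ h1) (ZE _ _ h2) ltrD2r.
  have -> : up (m + 1) (absz m).+1 = (up m (absz m).+1).+1 by rewrite /up; lia.
  exact: zi.
- have h1 : 0 <= m + K%:Z + (absz m * K)%N%:Z by nia.
  rewrite (ZE _ _ h1) /Z.
  have -> : up (m + K%:Z) (absz m) = (up m (absz m) + K)%N by rewrite /up; nia.
  by rewrite zp addrAC.
Qed.

(** The source of all homeomorphisms below other than translations: two
    interlaced sequences can be sent to two interlaced sequences of the same
    period, one carrying a periodic orbit that fixes the rotation number and the
    other carrying the displacements that are wanted elsewhere. *)
Lemma exists_homeo_two_orbits (K : nat) (x y x' y' : nat -> R) :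
  (0 < K)%N ->
  (forall n, x n < y n < x n.+1) -> (forall n, x (n + K)%N = x n + 1) ->
  (forall n, y (n + K)%N = y n + 1) ->
  (forall n, x' n < y' n < x' n.+1) -> (forall n, x' (n + K)%N = x' n + 1) ->
  (forall n, y' (n + K)%N = y' n + 1) ->
  exists f, [/\ homeo_tilde f, forall n, f (x n) = x' n & forall n, f (y n) = y' n].
Proof.
move=> K0 xy xp yp xy' xp' yp'.
pose mix (u v : nat -> R) n := if odd n then v n./2 else u n./2.
have K2 : (0 < K.*2)%N by rewrite double_gt0.
have mixS (u v : nat -> R) : (forall n, u n < v n < u n.+1) ->
    forall n, mix u v n < mix u v n.+1.
  move=> uv n; rewrite /mix oddS -uphalfE uphalf_half.
  by case: (odd n) => /=; [rewrite add1n|rewrite add0n]; have /andP[] := uv n./2.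
have mixp (u v : nat -> R) : (forall n, u (n + K)%N = u n + 1) ->
    (forall n, v (n + K)%N = v n + 1) ->
    forall n, mix u v (n + K.*2)%N = mix u v n + 1.
  move=> up vp n; rewrite /mix oddD odd_double addbF halfD odd_double andbF add0n doubleK.
  by case: (odd n).
have [Z ZL hZ] := lattice_extension K2 (mixS _ _ xy) (mixp _ _ xp yp).
have [Z' Z'L hZ'] := lattice_extension K2 (mixS _ _ xy') (mixp _ _ xp' yp').
exists (pw_affine Z Z'); split; first exact: pw_affine_homeo ZL Z'L.
- move=> n; have : mix x y n.*2 = x n by rewrite /mix odd_double doubleK.
  move=> <-; rewrite -hZ (pw_affine_node _ _ ZL) hZ'.
  by rewrite /mix odd_double doubleK.
- move=> n; have : mix x y n.*2.+1 = y n by rewrite /mix /= odd_double /= uphalf_double.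
  move=> <-; rewrite -hZ (pw_affine_node _ _ ZL) hZ'.
  by rewrite /mix /= odd_double /= uphalf_double.
Qed.

End Homeos.

(** * Demands and their sums *)

Section Combinatorics.
Local Open Scope nat_scope.

Lemma periodic_mod (F : nat -> nat) q k : (forall k, F (k + q) = F k) ->
  F k = F (k %% q).
Proof.
move=> Fp; rewrite {1}(divn_eq k q) addnC.
by elim: (k %/ q) => [|i IH]; rewrite ?addn0 // mulSn addnCA addnC Fp.
Qed.

Lemma sum_periods (F : nat -> nat) g c : (forall k, F (k + g) = F k) ->
  \sum_(k < c * g) F k = c * \sum_(k < g) F k.
Proof.
move=> Fp; elim: c => [|c IH]; first by rewrite mul0n big_ord0.
rewrite !mulSn big_split_ord /= -IH; congr (_ + _).
by apply: eq_bigr => i _; rewrite addnC Fp.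
Qed.

(** For u prime to q, [m |-> u m + c] permutes the residues modulo q. *)
Lemma sum_affine (F : nat -> nat) q u c : 0 < q -> coprime q u ->
  (forall k, F (k + q) = F k) ->
  \sum_(m < q) F (u * m + c) = \sum_(k < q) F k.
Proof.
move=> q0 cop Fp.
pose h (m : 'I_q) : 'I_q := Ordinal (ltn_pmod (u * m + c) q0).
have hinj : injective h.
  suff W (a b : 'I_q) : a <= b -> h a = h b -> a = b.
    by move=> a b hab; case/orP: (leq_total a b) => /W; [exact|move=> W'; symmetry; exact: W'].
  move=> ab /(congr1 val)/= /eqP; rewrite eq_sym eqn_mod_dvd; last first.
    by rewrite leq_add2r leq_mul2l ab orbT.
  rewrite subnDr -mulnBr Gauss_dvdr // => /dvdnP[[|k]] e.
    by apply/val_inj/eqP; rewrite eqn_leq ab -subn_eq0 e.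
  have := ltn_ord b; have : q <= b - a by rewrite e mulSn leq_addr.
  lia.
rewrite [RHS](reindex_inj hinj); apply: eq_bigr => m _ /=.
exact: periodic_mod.
Qed.

(** Bezout with natural coefficients: the multiples of h fill the multiples of
    gcd q h modulo q. *)
Lemma solve_mod q h a b : 0 < q -> 0 < h -> a = b %[mod gcdn q h] ->
  exists l, l * h + a = b %[mod q].
Proof.
move=> q0 h0 ab; case: (egcdnP q h0) => km kn e _.
have g0 : 0 < gcdn q h by rewrite gcdn_gt0 q0.
have /dvdnP[z hz] : gcdn q h %| b + a * (q - 1).
  rewrite /dvdn -modnDml -ab modnDml -[X in X + _]muln1 -mulnDr subnKC //.
  by apply: dvdn_mull; exact: dvdn_gcdl.
exists (km * z).
have -> : km * z * h = kn * z * q + z * gcdn q h.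
  by rewrite mulnAC e mulnDl gcdnC; lia.
have aq : a * (q - 1) + a = a * q by rewrite -[X in _ + X]muln1 -mulnDr subnK.
have -> : kn * z * q + z * gcdn q h + a = (kn * z + a) * q + b.
  by rewrite -hz mulnDl -aq; lia.
by rewrite modnMDl.
Qed.

Variables (alpha beta : nat -> nat).

(** The alphas and betas are indexed by all naturals so that suffixes of the word
    are again of this form. *)
Definition blocks j n : pos_word :=
  flatten [seq nseq (alpha i) La ++ nseq (beta i) Lb | i <- index_iota j n].

(** A word acts as a composition, so the letters to the right of a block act
    before it: this is the number of letters a applied before the j-th power
    of b. *)
Definition a_before n j := \sum_(j.+1 <= i < n) alpha i.

(** The exponent that an interval of a periodic orbit of a has to accommodate
    when repetitions of the word reach it after k letters a; only k modulo g
    matters, since the repetitions mix the residues of one class. *)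
Definition demand n g k :=
  \max_(j < n | a_before n j == k %[mod g]) beta j.

Lemma blocks_cat i j n : i <= j <= n -> blocks i n = blocks i j ++ blocks j n.
Proof.
move=> /andP[ij jn]; rewrite /blocks -flatten_cat -map_cat /index_iota.
have -> : n - i = (j - i) + (n - j) by lia.
by rewrite iotaD subnKC.
Qed.

Lemma blocks_recl j n : j < n ->
  blocks j n = nseq (alpha j) La ++ nseq (beta j) Lb ++ blocks j.+1 n.
Proof.
move=> jn; rewrite /blocks /index_iota.
have -> : n - j = (n - j.+1).+1 by lia.
by rewrite /= -catA.
Qed.

Lemma h_a_blocks j n : h_a (blocks j n) = \sum_(j <= i < n) alpha i.
Proof.
rewrite /h_a count_flatten sumnE !big_map; apply: eq_bigr => i _.
by rewrite count_cat !count_nseq mul1n mul0n addn0.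
Qed.

Lemma h_b_blocks j n : h_b (blocks j n) = \sum_(j <= i < n) beta i.
Proof.
rewrite /h_b count_flatten sumnE !big_map; apply: eq_bigr => i _.
by rewrite count_cat !count_nseq mul1n mul0n add0n.
Qed.

Lemma demandD n g k : demand n g (k + g) = demand n g k.
Proof. by apply: eq_bigl => j; rewrite modnDr. Qed.

Lemma demand_eq_mod n g k k' : k = k' %[mod g] -> demand n g k = demand n g k'.
Proof. by move=> e; apply: eq_bigl => j; rewrite e. Qed.

Lemma leq_demand n g k j : j < n -> a_before n j = k %[mod g] ->
  beta j <= demand n g k.
Proof.
move=> jn e.
exact: (@leq_bigmax_cond _ _ (fun j : 'I_n => beta j) (Ordinal jn) (introT eqP e)).
Qed.

(** A maximum of naturals is at most their sum, and each block is counted in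
    exactly one residue class. *)
Lemma sum_demand_le n g : 0 < g ->
  \sum_(k < g) demand n g k <= \sum_(0 <= j < n) beta j.
Proof.
move=> g0.
have le1 (k : 'I_g) : demand n g k <=
    \sum_(j < n) (if a_before n j == k %[mod g] then beta j else 0).
  rewrite -big_mkcond /=; apply/bigmax_leqP => j jk.
  by rewrite (bigD1 j) //= leq_addr.
apply: (@leq_trans (\sum_(k < g) \sum_(j < n)
    (if a_before n j == k %[mod g] then beta j else 0))).
  by apply: leq_sum => k _; exact: le1.
rewrite exchange_big /= big_mkord leq_eqVlt; apply/orP; left; apply/eqP.
apply: eq_bigr => j _; rewrite -big_mkcond /=.
rewrite (bigD1 (Ordinal (ltn_pmod (a_before n j) g0))) /=; last by rewrite modn_mod.
rewrite big1 ?addn0 // => k /andP[/eqP e /eqP ne]; case: ne; apply: val_inj => /=.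
by rewrite e modn_small.
Qed.

Hypothesis alpha_gt0 : forall i, 0 < alpha i.

(** The counts [a_before n j] are distinct elements of [0, h_a), so the blocks
    contribute to different terms of the sum. *)
Lemma le_sum_demand_ha n g :
  \sum_(0 <= j < n) beta j <= \sum_(k < \sum_(0 <= j < n) alpha j) demand n g k.
Proof.
suff H j : j <= n -> \sum_(n - j <= i < n) beta i <=
    \sum_(k < \sum_(n - j <= i < n) alpha i) demand n g k.
  by have := H n (leqnn n); rewrite subnn.
elim: j => [|j IH] jn; first by rewrite subn0 !big_geq.
have lt : n - j.+1 < n by lia.
have e : (n - j.+1).+1 = n - j by lia.
rewrite !(big_ltn lt) e addnC.
have := leq_demand (k := a_before n (n - j.+1)) (g := g) lt (erefl _).
rewrite /a_before e; set A := \sum_(n - j <= i < n) alpha i => hb.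
have -> : alpha (n - j.+1) + A = A.+1 + (alpha (n - j.+1)).-1.
  by have := alpha_gt0 (n - j.+1); lia.
rewrite big_split_ord /= big_ord_recr /=.
by apply: leq_trans (leq_addr _ _); exact: leq_add (IH (ltnW jn)) hb.
Qed.

(** Averaging the previous inequality over the h_a / g periods of demand. *)
Lemma sum_demand_ge n g : g %| \sum_(0 <= j < n) alpha j ->
  (\sum_(0 <= j < n) beta j) * g <=
  (\sum_(k < g) demand n g k) * \sum_(0 <= j < n) alpha j.
Proof.
move=> /dvdnP[c e]; rewrite e mulnA leq_mul2r; apply/orP; right.
have := le_sum_demand_ha n g; rewrite e (sum_periods _ (demandD n g)).
by rewrite mulnC.
Qed.

Lemma sum_demand_le_max n g :
  \sum_(k < g) demand n g k <= g * \max_(j < n) beta j.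
Proof.
rewrite -[X in X * _]card_ord -sum_nat_const; apply: leq_sum => k _.
apply/bigmax_leqP => j _; exact: (@leq_bigmax _ (fun j : 'I_n => beta j)).
Qed.

Lemma sum_demand1 n : \sum_(k < 1) demand n 1 k = \max_(j < n) beta j.
Proof.
by rewrite big_ord1; apply: eq_bigl => j; rewrite !modn1.
Qed.

End Combinatorics.

(** * Words as circle maps *)

Section Words.
Context {R : realType}.
Implicit Types (f fa fb : R -> R) (w : pos_word).

Lemma word_map_cat fa fb w1 w2 x :
  word_map fa fb (w1 ++ w2) x = word_map fa fb w1 (word_map fa fb w2 x).
Proof. by elim: w1 => //= l w1 ->. Qed.

Lemma word_map_nseq fa fb l k x :
  word_map fa fb (nseq k l) x = iter k (if is_a l then fa else fb) x.
Proof. by elim: k => //= k ->. Qed.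

Lemma h_a_cons l w : h_a (l :: w) = (is_a l + h_a w)%N.
Proof. by []. Qed.

Lemma h_b_cons l w : h_b (l :: w) = (is_b l + h_b w)%N.
Proof. by []. Qed.

(** A map that somewhere moves a point by at least 1 has rotation number at
    least 1. *)
Lemma lt_add1_of_rot_lt1 f x : circle_lift f -> Defs.rot f < 1 -> f x < x + 1.
Proof.
move=> lf lt1; rewrite ltNge; apply/negP => h.
have := @rot_ge R f x 1 1 lf h; rewrite mul1r; lra.
Qed.

(** As b moves every point by less than 1, replacing each b by the translation by
    1 does not decrease the word, and that translation commutes with a. *)
Lemma rot_word_le fa fb w : circle_lift fa -> circle_lift fb -> Defs.rot fb < 1 ->
  Defs.rot (word_map fa fb w) <= (h_a w)%:R * Defs.rot fa + (h_b w)%:R.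
Proof.
move=> la lb lt1; have lw := lift_word w la lb.
have le1 x : word_map fa fb w x <= iter (h_a w) fa x + (h_b w)%:R.
  elim: w {lw} => [|[] w IH]; first by rewrite addr0.
    by rewrite h_a_cons h_b_cons /= -(liftDn _ _ la) (lift_le la).
  rewrite h_a_cons h_b_cons natrD [_ + (h_b w)%:R]addrC addrA /=.
  by apply: le_trans (ltW (lt_add1_of_rot_lt1 _ lb lt1)) _; rewrite lerD2r.
have len n : iter n (word_map fa fb w) 0 <= iter (n * h_a w) fa 0 + n%:R * (h_b w)%:R.
  elim: n => [|n IH]; first by rewrite mul0r addr0.
  rewrite iterS mulSn iterD; apply: le_trans (lift_le lw IH) _.
  rewrite -natrM liftDn // natrM -natr1 mulrDl mul1r addrA addrAC lerD2r.
  exact: le1.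
rewrite -subr_le0; apply: (@archi_le0 _ _ 2) => n.
have := len n; have := rot_bound n lw; have := rot_bound (n * h_a w) la.
rewrite natrM !ler_norml => /andP[? ?] /andP[? ?] ?; lra.
Qed.

Lemma continuous_word fa fb w : continuous fa -> continuous fb ->
  continuous (word_map fa fb w).
Proof.
move=> ca cb; elim: w => [|l w IH] x; first exact: cvg_id.
by case: l; [exact: (continuous_comp (IH x) (ca _))|exact: (continuous_comp (IH x) (cb _))].
Qed.

End Words.

(** * The extremal rotation number bounds the demand *)

Section Necessity.
Context {R : realType}.
Implicit Types (f fa fb : R -> R) (w : pos_word).

(** An orbit of a map with rotation number p / q, ordered along the line. With
    u p = v q + 1, the map [f^u - v] is the successor on this orbit, so its
    iterates enumerate the orbit in increasing order. *)
Lemma periodic_orbit_lattice f (p q : nat) : circle_lift f -> continuous f ->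
  (0 < p)%N -> (0 < q)%N -> coprime p q -> q%:R * Defs.rot f = p%:R ->
  exists x : nat -> R, [/\ forall m, x m <= x m.+1,
    forall m, x (m + q)%N = x m + 1 & forall m, f (x m) = x (m + p)%N].
Proof.
move=> lf cf p0 q0 cop hrot.
have [x0 hx0] := @rot_rational_periodic R f p q lf cf q0 hrot.
have per k : iter (k * q) f x0 = x0 + (k * p)%N%:R.
  by rewrite (iter_shift k lf hx0) natrM.
case: (egcdnP q p0) => u v; rewrite (eqP cop) => uv _.
pose G y := iter u f y - v%:R.
have lG : circle_lift G.
  have [h1 h2] := lift_iter u lf.
  by split=> [y z yz|y]; rewrite /G; [rewrite lerD2r h1|rewrite h2 addrAC].
have GE m y : iter m G y = iter (m * u) f y - (m * v)%N%:R.
  elim: m => [|m IH]; first by rewrite subr0.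
  rewrite iterS IH /G liftBn; last exact: lift_iter.
  by rewrite -iterD -mulSn -addrA -opprD -natrD addnC -mulSn.
have Gq : iter q G x0 = x0 + 1.
  rewrite GE mulnC per uv [(q * v)%N]mulnC natrD; lra.
have x0G : x0 <= G x0.
  rewrite leNgt; apply/negP => lt.
  have := @iter_shift_le R G x0 0 1 q lG.
  rewrite addr0 => /(_ (ltW lt)); rewrite muln1 Gq mulr0; lra.
exists (fun m => iter m G x0); split=> m.
- by rewrite iterSr; apply: lift_le x0G; exact: lift_iter.
- by rewrite iterD Gq (liftDn _ 1) //; exact: lift_iter.
- rewrite !GE liftBn // -iterS.
  have -> : ((m + p) * u = (m * u).+1 + v * q)%N by rewrite mulnDl [(p * u)%N]mulnC uv; lia.
  rewrite iterD per liftDn; last exact: lift_iter.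
  rewrite mulnDl natrD [(p * v)%N]mulnC; lra.
Qed.

Section Orbit.
Variables (fa fb : R -> R) (p q : nat) (x : nat -> R).
Hypotheses (la : circle_lift fa) (lb : circle_lift fb) (fb1 : forall y, fb y <= y + 1).
Hypotheses (q0 : (0 < q)%N) (xS : forall m, x m <= x m.+1).
Hypotheses (xq : forall m, x (m + q)%N = x m + 1).
Hypotheses (xp : forall m, fa (x m) = x (m + p)%N).

Lemma orbit_shift m k : x (m + k * q)%N = x m + k%:R.
Proof.
elim: k => [|k IH]; first by rewrite addn0 addr0.
have -> : (m + k.+1 * q = m + k * q + q)%N by rewrite mulSn; lia.
by rewrite xq IH -natr1 addrA.
Qed.

Lemma word_orbit_le w m :
  word_map fa fb w (x m) <= x (m + h_a w * p)%N + (h_b w)%:R.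
Proof.
elim: w => [|[] w IH]; first by rewrite addn0 addr0.
  rewrite h_a_cons h_b_cons /=; apply: le_trans (lift_le la IH) _.
  by rewrite liftDn // xp mulSn [(p + _)%N]addnC addnA.
rewrite h_a_cons h_b_cons natrD [_ + (h_b w)%:R]addrC addrA /=.
by apply: le_trans (lift_le lb IH) _; apply: le_trans (fb1 _) _.
Qed.

Lemma iter_word_orbit_le w m l : iter l (word_map fa fb w) (x m) <=
  x (m + l * (h_a w * p))%N + (l * h_b w)%N%:R.
Proof.
elim: l => [|l IH]; first by rewrite addn0 addr0.
rewrite iterS; apply: le_trans (lift_le (lift_word w la lb) IH) _.
rewrite liftDn; last exact: lift_word.
have := word_orbit_le w (m + l * (h_a w * p)).
have -> : (m + l * (h_a w * p) + h_a w * p = m + l.+1 * (h_a w * p))%N by rewrite mulSn; lia.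
rewrite [(l.+1 * h_b w)%N]mulSn natrD; lra.
Qed.

(** A point that returns to itself up to the maximal displacement must stay
    between two consecutive orbit points, apart from the forced displacements:
    if a power of b carried it below the lower one, neither a, which maps the
    orbit to itself in order, nor b, which moves points by at most 1, could
    bring it back. A power of b that carries even the upper end below the lower
    one would do so. *)
Lemma block_visit w U1 U2 k y i l :
  w = U1 ++ nseq k Lb ++ U2 ->
  iter q (word_map fa fb w) y = y + (h_a w * p + q * h_b w)%N%:R ->
  x i < y <= x i.+1 ->
  forall m, m = (i + (l * h_a w + h_a U2) * p)%N ->
  x m + k%:R <= iter k fb (x m.+1).
Proof.
move=> wE hy /andP[iy yi] m mE; rewrite leNgt; apply/negP => lt.
set V := word_map fa fb w in hy; have lV : circle_lift V by exact: lift_word.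
have lU1 := lift_word U1 la lb; have lU2 := lift_word U2 la lb.
have lk := lift_iter k lb.
have VE z : V z = word_map fa fb U1 (iter k fb (word_map fa fb U2 z)).
  by rewrite /V wE !word_map_cat word_map_nseq.
have haE : h_a w = (h_a U1 + h_a U2)%N.
  by rewrite wE /h_a !count_cat count_nseq mul0n.
have hbE : h_b w = (h_b U1 + k + h_b U2)%N.
  by rewrite wE /h_b !count_cat count_nseq mul1n addnA.
have s1 : iter l V y <= x (i.+1 + l * (h_a w * p))%N + (l * h_b w)%N%:R.
  exact: le_trans (lift_le (lift_iter l lV) yi) (iter_word_orbit_le _ _ _).
have s2 : word_map fa fb U2 (iter l V y) <= x m.+1 + (l * h_b w + h_b U2)%N%:R.
  apply: le_trans (lift_le lU2 s1) _; rewrite liftDn // natrD addrA [leRHS]addrAC lerD2r.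
  apply: le_trans (word_orbit_le _ _) _; rewrite lerD2r.
  by have -> : (i.+1 + l * (h_a w * p) + h_a U2 * p = m.+1)%N by rewrite mE; lia.
have s3 : iter k fb (word_map fa fb U2 (iter l V y)) <=
    x m + (k + (l * h_b w + h_b U2))%N%:R.
  apply: le_trans (lift_le lk s2) _; rewrite liftDn // natrD; lra.
have s4 : iter l.+1 V y <= x (i + l.+1 * (h_a w * p))%N + (l.+1 * h_b w)%N%:R.
  rewrite iterS VE; apply: le_trans (lift_le lU1 s3) _; rewrite liftDn //.
  have := word_orbit_le U1 m.
  have -> : (m + h_a U1 * p = i + l.+1 * (h_a w * p))%N by rewrite mE haE; lia.
  have -> : (l.+1 * h_b w = h_b U1 + (k + (l * h_b w + h_b U2)))%N by rewrite mulSn {1}hbE; lia.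
  rewrite [(h_b U1 + _)%N%:R]natrD; lra.
have {s4} := lift_le (lift_iter (l.+1 * q - l.+1) lV) s4.
rewrite -iterD subnK; last by rewrite leq_pmulr.
have -> : iter (l.+1 * q) V y = y + l.+1%:R * (h_a w * p + q * h_b w)%N%:R.
  exact: (@iter_shift R V y (h_a w * p + q * h_b w)%N).
rewrite liftDn; last exact: lift_iter.
have := iter_word_orbit_le w (i + l.+1 * (h_a w * p)) (l.+1 * q - l.+1).
have -> : (i + l.+1 * (h_a w * p) + (l.+1 * q - l.+1) * (h_a w * p) =
   i + (l.+1 * (h_a w * p)) * q)%N.
  by rewrite -addnA -mulnDl subnKC ?leq_pmulr // mulnAC.
rewrite orbit_shift -/V => h1 h2.
have e : (l.+1%:R * (h_a w * p + q * h_b w)%N%:R =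
   (l.+1 * (h_a w * p))%N%:R + ((l.+1 * q - l.+1) * h_b w)%N%:R + (l.+1 * h_b w)%N%:R :> R).
  rewrite -natrM -!natrD; congr (_%:R).
  by rewrite -addnA -mulnDl subnK ?leq_pmulr // mulnDr -[X in _ = (_ + X)%N]mulnA.
by clear wE; lra.
Qed.

Lemma orbit_cell y : x 0 < y -> y <= x 0 + 1 ->
  exists2 i, (i < q)%N & x i < y <= x i.+1.
Proof.
move=> y0; rewrite -[x 0 + 1]xq add0n => yq.
elim: q yq => [|k IH] yk; first lra.
have [/IH[i ik hi]|lt] := leP y (x k); first by exists i => //; exact: leqW.
by exists k => //; rewrite lt.
Qed.

Variables (alpha beta : nat -> nat) (n : nat).
Let w := blocks alpha beta 0 n.
Let g := gcdn q (h_a w).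

(** As u inverts p modulo q, the interval of index i + r is visited after c
    letters a, from the interval of index i, when c = u r modulo q. Repetitions of
    the word add multiples of h_a to c, which modulo q fill the multiples of g, so
    every block with c = u r modulo g is applied in that interval. *)
Lemma demand_visit y i r u v :
  (0 < h_a w)%N -> (u * p = v * q + 1)%N ->
  iter q (word_map fa fb w) y = y + (h_a w * p + q * h_b w)%N%:R ->
  x i < y <= x i.+1 ->
  let k := demand alpha beta n g (u * r) in
  x (i + r)%N + k%:R <= iter k fb (x (i + r).+1).
Proof.
move=> h0 uv hy hi; apply: (big_ind (fun k => x (i + r)%N + k%:R <= iter k fb (x (i + r).+1))).
- by rewrite addr0.
- by move=> k1 k2 h1 h2; case: (leqP k1 k2) => _.
move=> j /eqP hj.
have wE : w = (blocks alpha beta 0 j ++ nseq (alpha j) La) ++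
    nseq (beta j) Lb ++ blocks alpha beta j.+1 n.
  rewrite /w (@blocks_cat _ _ 0 j n); last by rewrite leq0n ltnW.
  by rewrite (@blocks_recl _ _ j n) // -catA.
have hA : h_a (blocks alpha beta j.+1 n) = a_before alpha n j by rewrite h_a_blocks.
have [l hl] := solve_mod q0 h0 hj.
have := block_visit wE hy hi (erefl (i + (l * h_a w + _) * p)%N); rewrite hA.
set c := ((l * h_a w + a_before alpha n j) * p)%N.
have hc : c = r %[mod q].
  rewrite /c -modnMml hl modnMml mulnAC uv mulnDl mul1n mulnAC modnMDl //.
have per k : x (i + k)%N + (beta j)%:R <= iter (beta j) fb (x (i + k).+1) <->
    x (i + k %% q)%N + (beta j)%:R <= iter (beta j) fb (x (i + k %% q).+1).
  have e : (i + k = i + k %% q + (k %/ q) * q)%N by rewrite {1}(divn_eq k q); lia.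
  rewrite e -addSn !orbit_shift liftDn; last exact: lift_iter.
  by rewrite addrAC lerD2r.
by move=> H; apply/per; rewrite -hc; move/per: H.
Qed.

End Orbit.

(** Chaining the visits over one period of the orbit gives a point that all the
    demanded applications of b, S in number, move by at least S - 1. *)
Lemma demand_necessary fa fb (p q n : nat) (alpha beta : nat -> nat) :
  let w := blocks alpha beta 0 n in let g := gcdn q (h_a w) in
  (0 < h_a w)%N -> (0 < p)%N -> (0 < q)%N -> coprime p q ->
  homeo_tilde fa -> homeo_tilde fb -> Defs.rot fb < 1 ->
  Defs.rot fa = p%:R / q%:R ->
  Defs.rot (word_map fa fb w) = (h_a w)%:R * (p%:R / q%:R) + (h_b w)%:R ->
  ((q %/ g) * \sum_(k < g) demand alpha beta n g k)%N%:R * (1 - Defs.rot fb) <= 1.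
Proof.
move=> w g h0 p0 q0 cop Ha Hb lt1 ra rw.
have la := lift_homeo Ha; have lb := lift_homeo Hb.
have [ca _ _ _] := Ha; have [cb _ _ _] := Hb.
have fb1 y : fb y <= y + 1 by rewrite ltW // lt_add1_of_rot_lt1.
have qn0 : q%:R != 0 :> R by rewrite pnatr_eq0 -lt0n.
have [x [xS xq xp]] : exists x : nat -> R, [/\ forall m, x m <= x m.+1,
    forall m, x (m + q)%N = x m + 1 & forall m, fa (x m) = x (m + p)%N].
  by apply: periodic_orbit_lattice => //; rewrite ra mulrC divfK.
have lw := lift_word w la lb.
have [y0 hy0] : exists y, iter q (word_map fa fb w) y =
    y + (Posz (h_a w * p + q * h_b w)%N)%:~R.
  apply: rot_rational_periodic => //; first exact: continuous_word.
  rewrite rw -pmulrn natrD !natrM; field.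
  by [].
(* An integer translate of the periodic point lies in the first period of the
   orbit. *)
have [y [hy y1 y2]] : exists y, [/\ iter q (word_map fa fb w) y =
    y + (h_a w * p + q * h_b w)%N%:R, x 0 < y & y <= x 0 + 1].
  pose d := Num.floor (x 0%N - y0); exists (y0 + (d + 1)%:~R).
  have := floor_le (x 0%N - y0); have := floorD1_gt (x 0%N - y0); rewrite -/d => d1 d2.
  split; last by rewrite rmorphD /=; lra.
    by rewrite liftDz ?hy0 1?addrAC //; exact: lift_iter.
  lra.
have [i iq hi] := orbit_cell xq y1 y2.
case: (egcdnP q p0) => u v; rewrite (eqP cop) => uv _.
pose B r := demand alpha beta n g (u * r).
have chain c : x i + (\sum_(r < c) B r)%N%:R <=
    iter (\sum_(r < c) B r)%N fb (x (i + c)%N).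
  elim: c => [|c IH]; first by rewrite big_ord0 addn0 addr0.
  rewrite big_ord_recr /= iterD.
  have lS := lift_iter (\sum_(r < c) B r)%N lb.
  have := @demand_visit fa fb p q x la lb fb1 q0 xS xq xp alpha beta n y i c u v h0 uv hy hi.
  rewrite /= -/w -/g -/(B c) => /(lift_le lS); rewrite liftDn // addnS natrD.
  move: IH; lra.
have gq : (g %| q)%N by exact: dvdn_gcdl.
have eS : (\sum_(r < q) B r = (q %/ g) * \sum_(k < g) demand alpha beta n g k)%N.
  rewrite -sum_periods; last exact: demandD.
  rewrite divnK //.
  have copu : coprime q u.
    rewrite /coprime -dvdn1; have := dvdn_mulr p (dvdn_gcdr q u); rewrite uv.
    by rewrite dvdn_addr //; apply: dvdn_mull; exact: dvdn_gcdl.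
  rewrite -(@sum_affine (demand alpha beta n g) q u 0 q0 copu).
    by apply: eq_bigr => r _; rewrite addn0.
  move=> k; apply: demand_eq_mod; have /dvdnP[e ->] := gq.
  by rewrite addnC modnMDl.
rewrite -eS; set S := (\sum_(r < q) B r)%N in eS *.
have := chain q; rewrite xq (liftDn _ 1) -/S; last exact: lift_iter.
move=> hS; have := @rot_ge R fb (x i) (S%:Z - 1) S lb; rewrite rmorphB /= -pmulrn.
move=> H; have : x i + (S%:R - 1) <= iter S fb (x i) by lra.
by move=> /H; lra.
Qed.

End Necessity.

(** * Maps that realise a given demand *)

Section Sufficiency.
Context {R : realType}.
Implicit Types (f fa fb : R -> R) (u v t : R).

(** The maps b of the construction: modulo 1 they go back by one step of length
    1/S, but gain height from u to v inside the steps. For t > 1 - 1/S a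
    translation does it. The translation by 1 - 1/S gains nothing, and there b
    is a map with a periodic orbit of that rotation number that pushes some
    point of each gap of the orbit further up. *)
Lemma exists_fast_homeo (S : nat) t : (0 < S)%N -> t < 1 -> S%:R * (1 - t) <= 1 ->
  exists f u v, [/\ homeo_tilde f, Defs.rot f = t, u < v <= u + S%:R^-1 &
    forall j : nat, j%:R / S%:R + v + 1 <= f (j.+1%:R / S%:R + u)].
Proof.
move=> S0 t1; have Sp : 0 < S%:R :> R by rewrite ltr0n.
have SV : S%:R * S%:R^-1 = 1 :> R by rewrite divff // gt_eqF.
rewrite le_eqVlt => /predU1P[tE|tlt]; last first.
  exists (fun x => x + t), 0, (S%:R^-1 - (1 - t)); split.
  - exact: homeo_translation.
  - exact: rot_translation.
  - have h : 1 - t < S%:R^-1 by rewrite -div1r ltr_pdivlMr // mulrC.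
    by apply/andP; split; lra.
  - by move=> j; rewrite -natr1 mulrDl; lra.
pose x n : R := n%:R / S%:R; pose d : R := S%:R^-1 / 3.
have d0 : 0 < d by rewrite divr_gt0 ?invr_gt0.
have d3 : S%:R^-1 = d * 3 by rewrite /d divfK.
have xS n : x n.+1 = x n + d * 3 by rewrite /x -natr1 mulrDl mul1r -d3.
have xD n : x (n + S)%N = x n + 1 by rewrite /x natrD mulrDl divff // gt_eqF.
have SE : (S.-1 + S = S + S.-1)%N by lia.
have [f [Hf fx fy]] : exists f, [/\ homeo_tilde f,
    forall n, f (x n) = x (n + S.-1)%N &
    forall n, f (x n + d) = x (n + S.-1)%N + d * 2].
  apply: (@exists_homeo_two_orbits R S x (fun n => x n + d)
    (fun n => x (n + S.-1)%N) (fun n => x (n + S.-1)%N + d * 2)) => //.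
  - by move=> n; rewrite xS; apply/andP; split; lra.
  - by move=> n; rewrite xD addrAC.
  - by move=> n; rewrite addSn xS; apply/andP; split; lra.
  - by move=> n; rewrite -addnA [(S + _)%N]addnC addnA xD.
  - by move=> n; rewrite -addnA [(S + _)%N]addnC addnA xD addrAC.
have lf := lift_homeo Hf.
exists f, d, (d * 2); split=> //.
- have it k : iter k f (x 0%N) = x (k * S.-1)%N.
    elim: k => [|k IH]; first by rewrite mul0n.
    by rewrite iterS IH fx mulSn addnC.
  have := @rot_periodic R f (x 0%N) (S.-1)%:Z S lf.
  rewrite it -pmulrn; have -> : x (S * S.-1)%N = x 0%N + S.-1%:R.
    by rewrite /x mul0r add0r natrM mulrAC divff ?mul1r // gt_eqF.
  have -> : S.-1%:R = S%:R - 1 :> R by rewrite -{2}(prednK S0) -natr1 addrK.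
  move=> /(_ (erefl _)) h.
  have : S%:R * (Defs.rot f - t) = 0 by lra.
  by move=> /eqP; rewrite mulf_eq0 gt_eqF //= subr_eq0 => /eqP.
- by apply/andP; split; lra.
- move=> j; have -> : j.+1%:R / S%:R + d = x j.+1 + d by [].
  rewrite fy; have -> : (j.+1 + S.-1 = j + S)%N by lia.
  by rewrite xD -/(x j); lra.
Qed.

Section Run.
Variables (S : nat) (u v : R) (fb : R -> R).
Hypotheses (S0 : (0 < S)%N) (lb : circle_lift fb) (uv : u < v <= u + S%:R^-1).
Hypothesis fbE : forall j : nat, j%:R / S%:R + v + 1 <= fb (j.+1%:R / S%:R + u).

Lemma iter_fast (j k : nat) : (0 < k)%N ->
  j%:R / S%:R + v + k%:R <= iter k fb ((j + k)%N%:R / S%:R + u).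
Proof.
case: k => // k _; elim: k => [|k IH]; first by rewrite addn1; exact: fbE.
have lk := lift_iter k.+1 lb.
rewrite iterSr addnS; apply: le_trans (lift_le lk (fbE _)).
have /(lift_le lk) : (j + k.+1)%N%:R / S%:R + u <= (j + k.+1)%N%:R / S%:R + v.
  by rewrite lerD2l; case/andP: uv => /ltW.
rewrite (liftDn _ 1) // -[k.+2%:R]natr1; lra.
Qed.

Variables (B : nat -> nat) (q : nat).
Hypotheses (q0 : (0 < q)%N) (Bq : forall m, B (m + q)%N = B m).
Hypotheses (Blast : (0 < B q.-1)%N) (SE : S = (\sum_(m < q) B m)%N).

Let s m := (\sum_(r < m) B r)%N.

Lemma partial_sum_shift m : s (m + q)%N = (s m + S)%N.
Proof.
rewrite SE /s; elim: m => [|m IH]; first by rewrite big_ord0.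
by rewrite addSn !big_ord_recr /= IH Bq addnAC.
Qed.

(** The point of index m sits in the s m-th step of length 1/S, at a height in
    the window [u, v] that increases with m; the window is reset once per
    period, where the last interval has a positive demand. *)
Let pt (c : R) m :=
  (s m)%:R / S%:R + u + (v - u) * ((m %% q)%:R + c) / (q%:R + 1).

Let q1 : 0 < q%:R + 1 :> R. Proof. by rewrite natr1. Qed.
Let Sp : 0 < S%:R :> R. Proof. by rewrite ltr0n. Qed.
Let vu : 0 < v - u. Proof. by case/andP: uv; lra. Qed.
Let e := (v - u) / (q%:R + 1).
Let e0 : 0 < e. Proof. by rewrite divr_gt0. Qed.

Lemma ptE c m : pt c m = (s m)%:R / S%:R + u + e * ((m %% q)%:R + c).
Proof. by rewrite /pt /e [(v - u) / _ * _]mulrAC. Qed.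

Lemma pt_shift c m : pt c (m + q)%N = pt c m + 1.
Proof.
rewrite !ptE modnDr partial_sum_shift natrD mulrDl divff ?gt_eqF //; lra.
Qed.

Lemma pt_le c m : c <= 1 -> pt c m <= (s m)%:R / S%:R + v.
Proof.
move=> c1; rewrite ptE.
have h : e * ((m %% q)%:R + c) <= e * (q%:R + 1).
  rewrite ler_pM2l //; apply: lerD => //; rewrite ler_nat ltnW //.
  exact: ltn_pmod.
have : e * (q%:R + 1) = v - u by rewrite /e divfK // gt_eqF.
lra.
Qed.

Lemma pt_ge c m : 0 <= c -> (s m)%:R / S%:R + u <= pt c m.
Proof.
by move=> c0; rewrite ptE lerDl; apply: mulr_ge0; [exact: ltW|exact: addr_ge0].
Qed.

(** Inside a period the height increases; at its end the demand is positive, and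
    one step of length 1/S makes up for the reset of the height. *)
Lemma pt_next m : pt 1 m <= pt (1 / 2) m.+1.
Proof.
have sS : s m.+1 = (s m + B m)%N by rewrite /s big_ord_recr.
have [mlast|mlt] := eqVneq (m %% q).+1 q.
  have Bm : (1 <= B m)%N by rewrite (periodic_mod m Bq) -[(m %% q)%N]/((m %% q).+1.-1) mlast.
  apply: le_trans (pt_le _ (lexx 1)) (le_trans _ (@pt_ge (1 / 2) _ _)); last by lra.
  rewrite sS natrD mulrDl.
  have : 1 / S%:R <= (B m)%:R / S%:R :> R by rewrite ler_pM2r ?invr_gt0 // (ler_nat _ 1).
  case/andP: uv; lra.
have lt : ((m %% q).+1 < q)%N by rewrite ltn_neqAle mlt ltn_pmod.
have mS : (m.+1 %% q = (m %% q).+1)%N by rewrite -addn1 -modnDml addn1 modn_small.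
rewrite !ptE mS sS natrD mulrDl -[(m %% q).+1%:R]natr1.
have : 0 <= (B m)%:R / S%:R :> R by rewrite divr_ge0.
have := e0; lra.
Qed.

Lemma pt_lt c c' m : c < c' -> pt c m < pt c' m.
Proof. by move=> cc; rewrite !ptE ltrD2l ltr_pM2l // ltrD2l. Qed.

(** The points [pt (3 / 4) m] form an orbit that gives the rotation number p / q
    and bound the intervals. The point [pt 1 m] just above the lower end of an
    interval goes to the point just below the upper end of the image interval:
    a climbs as much as its periodic orbit allows. *)
Lemma exists_lattice_homeo (p : nat) : exists fa, [/\ homeo_tilde fa,
  q%:R * Defs.rot fa = p%:R & forall m, fa (pt 1 m) = pt (1 / 2) (m + p).+1].
Proof.
have h1 : 1 / 2 < 3 / 4 :> R by lra.
have h2 : 3 / 4 < 1 :> R by lra.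
have [fa [Ha hX hY]] := @exists_homeo_two_orbits R q (pt (3 / 4)) (pt 1)
  (fun m => pt (3 / 4) (m + p)%N) (fun m => pt (1 / 2) (m + p).+1) q0
  ltac:(move=> n; rewrite pt_lt //=; exact: le_lt_trans (pt_next n) (pt_lt _ h1))
  ltac:(move=> n; exact: pt_shift) ltac:(move=> n; exact: pt_shift)
  ltac:(move=> n; rewrite /= addSn pt_lt ?andbT //=; exact: lt_le_trans (pt_lt _ h2) (pt_next _))
  ltac:(move=> n; rewrite /= addnAC; exact: pt_shift)
  ltac:(move=> n; rewrite /= addnAC -addSn; exact: pt_shift).
exists fa; split=> //.
have it k : iter k fa (pt (3 / 4) 0) = pt (3 / 4) (k * p)%N.
  elim: k => [|k IH]; first by rewrite mul0n.
  by rewrite iterS IH hX mulSn addnC.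
have sh k : pt (3 / 4) (k * q)%N = pt (3 / 4) 0 + k%:R.
  elim: k => [|k IH]; first by rewrite mul0n addr0.
  by rewrite mulSn addnC pt_shift IH -[k.+1%:R]natr1 addrA.
apply: (@rot_periodic R fa (pt (3 / 4) 0) p%:Z q); first exact: lift_homeo.
by rewrite it mulnC sh.
Qed.

Variables (fa : R -> R) (p : nat).
Hypotheses (la : circle_lift fa).
Hypothesis faE : forall m, fa (pt 1 m) = pt (1 / 2) (m + p).+1.

Lemma iter_climb m k : (0 < k)%N -> pt (1 / 2) (m + k * p).+1 <= iter k fa (pt 1 m).
Proof.
case: k => // k _; elim: k m => [|k IH] m; first by rewrite mul1n /= faE.
have := IH (m + p)%N.
have -> : (m + p + k.+1 * p = m + k.+2 * p)%N by rewrite [(k.+2 * p)%N]mulSn addnA.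
move=> h; rewrite iterSr; apply: le_trans h (lift_le (lift_iter k.+1 la) _).
by rewrite faE pt_next.
Qed.

(** Modulo 1, up to [B m] applications of b to the top of an interval do not
    leave it: they go back at most [B m] steps, the length of the interval. *)
Lemma iter_descend m k : (0 < k <= B m)%N ->
  pt 1 m + k%:R <= iter k fb (pt (1 / 2) m.+1).
Proof.
move=> /andP[k0 km]; have lk := lift_iter k lb.
apply: le_trans (_ : (s m)%:R / S%:R + v + k%:R <= _).
  by rewrite lerD2r; exact: pt_le.
apply: le_trans (iter_fast _ k0) (lift_le lk _).
apply: le_trans (pt_ge _ _); last by lra.
by rewrite lerD2r ler_pM2r ?invr_gt0 // ler_nat /s big_ord_recr /= leq_add2l.
Qed.

Variables (alpha beta : nat -> nat) (n : nat).
Hypotheses (alpha0 : forall i, (0 < alpha i)%N) (beta0 : forall i, (0 < beta i)%N).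
Let w := blocks alpha beta 0 n.
Hypothesis Bbeta : forall j l, (j < n)%N ->
  (beta j <= B (q.-1 + (l * h_a w + a_before alpha n j) * p))%N.

(** Running through the word from the top of an interval: each power of b stays in
    the interval up to integers, and the following power of a returns to the top
    of a later one. The suffix length j counts the blocks already applied, in
    the l-th repetition of the word. *)
Lemma blocks_climb l j : (j <= n)%N ->
  let c := (l * h_a w + \sum_(n - j <= i < n) alpha i)%N in
  pt (1 / 2) (q + c * p)%N + (h_b (blocks alpha beta (n - j) n))%:R <=
  word_map fa fb (blocks alpha beta (n - j) n) (pt (1 / 2) (q + l * h_a w * p)%N).
Proof.
elim: j => [|j IH] jn.
  by rewrite /= subn0 /blocks big_geq // /index_iota subnn /= addr0 addn0.
have lt : (n - j.+1 < n)%N by lia.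
have jE : (n - j.+1).+1 = (n - j)%N by lia.
rewrite (@blocks_recl _ _ (n - j.+1) n) // (big_ltn lt) jE !word_map_cat !word_map_nseq /=.
set a := alpha _; set b := beta _; set A := (\sum_(n - j <= i < n) _)%N.
have := IH (ltnW jn); rewrite /= -/A; set Z := word_map _ _ _ _ => hZ.
set m := (q.-1 + (l * h_a w + A) * p)%N.
have mS : (q + (l * h_a w + A) * p = m.+1)%N by rewrite /m; lia.
have bB : (0 < b <= B m)%N.
  by rewrite beta0 /=; have := Bbeta l lt; rewrite /a_before jE -/A.
have h1 := lift_le (lift_iter b lb) hZ.
have h2 := iter_descend bB.
have h3 := iter_climb m (alpha0 (n - j.+1)).
have hb : h_b (nseq a La ++ nseq b Lb ++ blocks alpha beta (n - j) n) =
    (b + h_b (blocks alpha beta (n - j) n))%N.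
  by rewrite /h_b !count_cat !count_nseq mul0n mul1n.
have la' := lift_iter a la.
have h4 : iter a fa (pt 1 m) + (b + h_b (blocks alpha beta (n - j) n))%N%:R <= iter a fa (iter b fb Z).
  rewrite -liftDn //; apply: lift_le => //.
  apply: le_trans h1; rewrite mS liftDn; last exact: lift_iter.
  by move: h2; rewrite natrD; lra.
rewrite hb; apply: le_trans h4; rewrite lerD2r.
by have -> : (q + (l * h_a w + (a + A)) * p = (m + a * p).+1)%N by rewrite /m; lia.
Qed.

Lemma rot_climb : (h_a w * p)%N%:R + (q * h_b w)%N%:R <=
  q%:R * Defs.rot (word_map fa fb w).
Proof.
have lw := lift_word w la lb; set V := word_map fa fb w.
have step l : pt (1 / 2) (q + l * h_a w * p)%N + (l * h_b w)%N%:R <=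
    iter l V (pt (1 / 2) q).
  elim: l => [|l IH]; first by rewrite addn0 addr0.
  rewrite iterS; apply: le_trans (lift_le lw IH); rewrite liftDn //.
  have := blocks_climb l (leqnn n); rewrite /= subnn -/w -(h_a_blocks alpha beta) -/w.
  have -> : (l * h_a w + h_a w = l.+1 * h_a w)%N by rewrite mulSn addnC.
  by rewrite [(l.+1 * h_b w)%N]mulSn natrD /V; lra.
have sh k : pt (1 / 2) (q + k * q)%N = pt (1 / 2) q + k%:R.
  elim: k => [|k IH]; first by rewrite mul0n addn0 addr0.
  by rewrite mulSn [(q + k * q)%N]addnC addnA pt_shift IH -[k.+1%:R]natr1 addrA.
have := @rot_ge R V (pt (1 / 2) q) (h_a w * p + q * h_b w)%N q lw.
rewrite -pmulrn natrD; apply.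
have := step q; have -> : (q * h_a w * p = h_a w * p * q)%N by lia.
rewrite sh; lra.
Qed.

End Run.

Lemma demand_sufficient (p q n : nat) (alpha beta : nat -> nat) t :
  let w := blocks alpha beta 0 n in let g := gcdn q (h_a w) in
  (forall i, 0 < alpha i)%N -> (forall i, 0 < beta i)%N -> (0 < n)%N ->
  (0 < p)%N -> (0 < q)%N -> coprime p q -> t < 1 ->
  ((q %/ g) * \sum_(k < g) demand alpha beta n g k)%N%:R * (1 - t) <= 1 ->
  exists fa fb : R -> R, [/\ homeo_tilde fa, homeo_tilde fb,
    Defs.rot fa = p%:R / q%:R, Defs.rot fb = t &
    (h_a w)%:R * (p%:R / q%:R) + (h_b w)%:R = Defs.rot (word_map fa fb w)].
Proof.
move=> w g alpha0 beta0 n0 p0 q0 cop t1 St.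
case: (egcdnP q p0) => u v; rewrite (eqP cop) => uv _.
have gq : (g %| q)%N by exact: dvdn_gcdl.
have gh : (g %| h_a w)%N by exact: dvdn_gcdr.
(* After c letters a the run is in the interval of index q - 1 + c p; this
   inverts c in terms of the index. The shift by q - 1 puts the demand of the
   last block, applied when c = 0, in the last interval of the period. *)
pose B m := demand alpha beta n g (u * m + u).
have Bq m : B (m + q)%N = B m.
  apply: demand_eq_mod; have /dvdnP[k ->] := gq.
  have -> : (u * (m + k * g) + u = u * k * g + (u * m + u))%N by lia.
  by rewrite modnMDl.
have Bbeta j l : (j < n)%N ->
    (beta j <= B (q.-1 + (l * h_a w + a_before alpha n j) * p))%N.
  move=> jn; apply: leq_demand => //.
  set A := a_before _ _ _.
  have -> : (u * (q.-1 + (l * h_a w + A) * p) + u =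
      u * q + (v * q + 1) * (l * h_a w + A))%N.
    by rewrite -uv -[in RHS](prednK q0); lia.
  have /dvdnP[k1 e1] := gq; have /dvdnP[k2 e2] := gh; rewrite e2 {1 2}e1.
  have -> : (u * (k1 * g) + (v * (k1 * g) + 1) * (l * (k2 * g) + A) =
    (u * k1 + v * k1 * (l * (k2 * g) + A) + l * k2) * g + A)%N by lia.
  by rewrite modnMDl.
have Blast : (0 < B q.-1)%N.
  have ltn1 : (n.-1 < n)%N by rewrite prednK.
  have := Bbeta _ 0%N ltn1.
  rewrite /a_before prednK // big_geq // mul0n addn0 mul0n addn0.
  exact: leq_trans (beta0 _).
have copu : coprime q u.
  rewrite /coprime -dvdn1; have := dvdn_mulr p (dvdn_gcdr q u); rewrite uv.
  by rewrite dvdn_addr //; apply: dvdn_mull; exact: dvdn_gcdl.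
have SE : ((q %/ g) * \sum_(k < g) demand alpha beta n g k = \sum_(m < q) B m)%N.
  rewrite -sum_periods; last exact: demandD.
  rewrite divnK // -(@sum_affine (demand alpha beta n g) q u u q0 copu) //.
  move=> k; apply: demand_eq_mod; have /dvdnP[k1 ->] := gq.
  by rewrite addnC modnMDl.
move: St; rewrite SE => St.
have S0 : (0 < \sum_(m < q) B m)%N.
  have lq : (q.-1 < q)%N by rewrite prednK.
  by rewrite (bigD1 (Ordinal lq)) //= addn_gt0 Blast.
have [fb [x [y [Hb rb xy hb]]]] := exists_fast_homeo S0 t1 St.
have [fa [Ha ra hfa]] := exists_lattice_homeo S0 xy q0 Bq Blast (erefl _) p.
have la := lift_homeo Ha; have lb := lift_homeo Hb.
have qp : 0 < q%:R :> R by rewrite ltr0n.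
have rE : Defs.rot fa = p%:R / q%:R.
  by apply: (mulfI (lt0r_neq0 qp)); rewrite ra mulrC divfK // gt_eqF.
exists fa, fb; split=> //.
apply/le_anti/andP; split; last first.
  by rewrite -rE; apply: rot_word_le => //; rewrite rb.
have := rot_climb S0 lb xy hb q0 Bq Blast (erefl _) la hfa alpha0 beta0 Bbeta.
rewrite -/w !natrM => h.
rewrite -(ler_pM2l qp) mulrDr; apply: le_trans h.
have -> : q%:R * ((h_a w)%:R * (p%:R / q%:R)) = (h_a w)%:R * p%:R :> R.
  by field; rewrite gt_eqF.
by [].
Qed.

End Sufficiency.

(** * The fringe length *)

Section Fringe.
Context {R : realType}.
Implicit Types (fa fb : R -> R) (w : pos_word) (r t m : R).

Lemma word_map_add fa fb w (c : int) x : circle_lift fa -> circle_lift fb ->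
  word_map (fun x => fa x + c%:~R) fb w x =
  word_map fa fb w x + ((h_a w)%:Z * c)%:~R.
Proof.
move=> la lb; elim: w => [|[] w IH]; first by rewrite mul0r addr0.
  by rewrite [LHS]/= IH liftDz // h_a_cons PoszD mulrDl mul1r rmorphD /= -addrA [c%:~R + _]addrC.
by rewrite [LHS]/= IH liftDz // h_a_cons.
Qed.

Lemma rot_values_add w r t x (c : int) : rot_values w r t x ->
  rot_values w (r + c%:~R) t (x + ((h_a w)%:Z * c)%:~R).
Proof.
move=> [fa [fb [Ha Hb ra rb ->]]]; have la := lift_homeo Ha; have lb := lift_homeo Hb.
exists (fun x => fa x + c%:~R), fb; split=> //.
- exact: homeo_add.
- by rewrite rot_shift // ra.
- rewrite -rot_shift; last exact: lift_word.
  by congr Defs.rot; apply/funext => y; rewrite word_map_add.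
Qed.

Lemma max_rot_add w r t m (c : int) : max_rot_is w r t m ->
  max_rot_is w (r + c%:~R) t (m + ((h_a w)%:Z * c)%:~R).
Proof.
move=> [h1 h2]; split; first exact: rot_values_add.
move=> y /(rot_values_add (- c)); rewrite rmorphN /= addrK => /h2.
by rewrite mulrN rmorphN /= lerBlDr.
Qed.

Section Blocks.
Variables (alpha beta : nat -> nat) (n : nat).
Hypotheses (alpha0 : forall i, (0 < alpha i)%N) (beta0 : forall i, (0 < beta i)%N).
Hypothesis n0 : (0 < n)%N.
Let w := blocks alpha beta 0 n.
Let D g := (\sum_(k < g) demand alpha beta n g k)%N.
Let S q := (q %/ gcdn q (h_a w) * D (gcdn q (h_a w)))%N.

Lemma h_a_gt0 : (0 < h_a w)%N.
Proof. by rewrite /w h_a_blocks big_ltn // ltn_addr. Qed.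

Lemma max_rot_iff_pos (p q : nat) t : (0 < p)%N -> (0 < q)%N -> coprime p q -> t < 1 ->
  max_rot_is w (p%:R / q%:R) t ((h_a w)%:R * (p%:R / q%:R) + (h_b w)%:R) <->
  (S q)%:R * (1 - t) <= 1.
Proof.
move=> p0 q0 cop t1; split.
- move=> [[fa [fb [Ha Hb ra rb rw]]] _]; rewrite -rb.
  by apply: (demand_necessary h_a_gt0 p0 q0 cop Ha Hb _ ra); rewrite ?rb // -rw.
- move=> St; split.
    exact: (demand_sufficient alpha0 beta0 n0 p0 q0 cop t1 St).
  move=> _ [fa [fb [Ha Hb ra rb ->]]].
  by rewrite -ra; apply: rot_word_le; rewrite ?rb //; exact: lift_homeo.
Qed.

(** Translating the first map by an integer reduces to a positive numerator,
    so that orbit indices only move forward. *)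
Lemma max_rot_iff (p : int) (q : nat) t : (0 < q)%N -> coprime `|p|%N q -> t < 1 ->
  max_rot_is w (p%:~R / q%:R) t ((h_a w)%:R * (p%:~R / q%:R) + (h_b w)%:R) <->
  (S q)%:R * (1 - t) <= 1.
Proof.
move=> q0 cop t1; pose c : int := (absz p).+1; pose p' := absz (p + c * q%:Z).
have p'E : p'%:Z = p + c * q%:Z by rewrite /p' /c; nia.
have p'0 : (0 < p')%N by rewrite /p' /c; nia.
have cop' : coprime p' q.
  have : coprimez (p + c * q%:Z) q%:Z.
    by rewrite coprimez_sym /coprimez addrC gcdzMDl -[_ == _]/(coprimez q%:Z p) coprimez_sym coprimezE.
  by rewrite coprimezE.
have rE : p'%:R / q%:R = p%:~R / q%:R + c%:~R :> R.
  have -> : p'%:R = p%:~R + c%:~R * q%:R :> R.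
    by rewrite [LHS](_ : _ = (p'%:Z)%:~R) // p'E rmorphD rmorphM.
  by field; rewrite pnatr_eq0 -lt0n.
have mE : (h_a w)%:R * (p'%:R / q%:R) + (h_b w)%:R =
    (h_a w)%:R * (p%:~R / q%:R) + (h_b w)%:R + ((h_a w)%:Z * c)%:~R :> R.
  by rewrite rE rmorphM /= -pmulrn; lra.
rewrite -(max_rot_iff_pos p'0 q0 cop' t1) rE -rE mE rE; split; first exact: max_rot_add.
move=> /(max_rot_add (- c)).
by rewrite mulrN !rmorphN /= !addrK.
Qed.

Lemma demand_total_gt0 q : (0 < q)%N -> (0 < S q)%N.
Proof.
move=> q0; have g0 : (0 < gcdn q (h_a w))%N by rewrite gcdn_gt0 q0.
rewrite muln_gt0 divn_gt0 // dvdn_leq ?dvdn_gcdl //=.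
rewrite /D (bigD1 (Ordinal g0)) //= addn_gt0; apply/orP; left.
have ltn1 : (n.-1 < n)%N by rewrite prednK.
apply: leq_trans (beta0 n.-1) (leq_demand _ ltn1 _).
by rewrite /a_before prednK // big_geq.
Qed.

(** For t < 1 the extremal value is attained exactly when S (1 - t) <= 1, and the
    threshold 1 - 1/S is rational, so it is itself the least start. *)
Lemma fr_formula (p : int) (q : nat) : (0 < q)%N -> coprime `|p|%N q ->
  fr w (p%:~R / q%:R : R) = (S q)%:R^-1.
Proof.
move=> q0 cop; have Sp := demand_total_gt0 q0.
have Sq : 0 < (S q)%:R :> rat by rewrite ltr0n.
have SR : 0 < (S q)%:R :> R by rewrite ltr0n.
pose s0 : rat := 1 - (S q)%:R^-1.
have s0E : ratr s0 = 1 - (S q)%:R^-1 :> R.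
  by rewrite /s0 rmorphB rmorph1 fmorphV rmorph_nat.
have iff t : t < 1 -> ratr s0 <= t <-> (S q)%:R * (1 - t) <= 1.
  move=> t1; rewrite s0E lerBlDl -lerBlDr.
  by rewrite -[(S q)%:R^-1]div1r ler_pdivlMr // mulrC.
have start : fringe_start w (p%:~R / q%:R : R) s0.
  split=> [|t /andP[ts t1]]; last by apply/max_rot_iff => //; apply/iff.
  rewrite /s0 subr_ge0 invf_le1 // (ler_nat _ 1) Sp /=.
  by rewrite ltrBlDr ltrDl invr_gt0.
have least : least_fringe_start w (p%:~R / q%:R : R) s0.
  split=> // s [/andP[s0' s1] hs].
  have s1R : ratr s < 1 :> R by rewrite -(rmorph1 (@ratr R)) ltr_rat.
  rewrite -(ler_rat R); apply/iff => //.
  by apply/(max_rot_iff q0 cop s1R); apply: hs; rewrite lexx.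
rewrite /fr (@xget_unique _ _ _ s0) //=; first by rewrite s0E; lra.
move=> s [hs ls]; apply/le_anti/andP; split; first exact: ls.
by case: least => _; apply.
Qed.

(** The Fringe Formula with its constant: sigma is the average demand over the
    residues modulo g. *)
Lemma sigma_formula (p : int) (q : nat) : (0 < q)%N -> coprime `|p|%N q ->
  let g := gcdn q (h_a w) in sigma R w g = (D g)%:R / g%:R.
Proof.
move=> q0 cop g.
have val (p' : int) (q' : nat) : (0 < q')%N -> coprime `|p'|%N q' ->
    gcdn q' (h_a w) = g -> 1 / (q'%:R * fr w (p'%:~R / q'%:R)) = (D g)%:R / g%:R :> R.
  move=> q'0 cop' gE; rewrite fr_formula //.
  have Sp := demand_total_gt0 q'0.
  have g0 : (0 < g)%N by rewrite gcdn_gt0 q0.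
  have qn : q'%:R != 0 :> R by rewrite pnatr_eq0 -lt0n.
  have gn : g%:R != 0 :> R by rewrite pnatr_eq0 -lt0n.
  have e : (S q' * g = q' * D g)%N.
    by rewrite /S gE mulnAC divnK // -gE dvdn_gcdl.
  have Sn : (S q')%:R != 0 :> R by rewrite pnatr_eq0 -lt0n.
  have : (S q')%:R * g%:R = q'%:R * (D g)%:R :> R by rewrite -!natrM e.
  move=> eR; rewrite invfM invrK mul1r mulrC; apply: (mulfI qn); rewrite mulrCA.
  by rewrite divff // mulr1 mulrA -eR mulfK.
rewrite /sigma (@xget_unique _ _ _ ((D g)%:R / g%:R)) //=.
  by move=> p' q' q'0 cop' gE; rewrite val.
by move=> x hx; rewrite (hx p q q0 cop (erefl _)) val.
Qed.

End Blocks.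
End Fringe.

Unset Implicit Arguments.
Set Strict Implicit.

Theorem theorem4p1 (R : realType) (n : nat) (alpha beta : 'I_n -> nat)
    (p : int) (q : nat) :
  (1 <= n)%N ->
  (forall i : 'I_n, (0 < alpha i)%N /\ (0 < beta i)%N) ->
  (1 <= q)%N -> coprime `|p|%N q ->
  let w := block_word alpha beta in
  let g := gcdn q (h_a w) in
  [/\ (h_b w)%:R / (h_a w)%:R <= sigma R w g <= (\max_(i < n) beta i)%:R,
      (h_a w %| q)%N -> sigma R w g = (h_b w)%:R / (h_a w)%:R &
      gcdn q (h_a w) = 1%N -> sigma R w g = (\max_(i < n) beta i)%:R].
Proof.
move=> n0 ab0 q0 cop w g.
(* The default value 1 keeps all exponents positive. *)
pose ext (f : 'I_n -> nat) i := if insub i is Some k then f k else 1%N.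
have extE f (i : 'I_n) : ext f i = f i by rewrite /ext valK.
have ext0 f i : (forall i, 0 < f i)%N -> (0 < ext f i)%N.
  by move=> f0; rewrite /ext; case: insubP.
have a0 i : (0 < ext alpha i)%N by apply: ext0 => k; case: (ab0 k).
have b0 i : (0 < ext beta i)%N by apply: ext0 => k; case: (ab0 k).
have wE : w = blocks (ext alpha) (ext beta) 0 n.
  rewrite /w /block_word /blocks /index_iota subn0 -val_enum_ord -map_comp.
  by congr flatten; apply: eq_map => i /=; rewrite !extE.
have maxE : (\max_(i < n) beta i = \max_(i < n) ext beta i)%N.
  by apply: eq_bigr => i _; rewrite extE.
have ha0 : (0 < h_a w)%N by rewrite wE; exact: h_a_gt0.
have g0 : (0 < g)%N by rewrite gcdn_gt0 ha0 orbT.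
set D := (\sum_(k < g) demand (ext alpha) (ext beta) n g k)%N.
have sE : sigma R w g = D%:R / g%:R.
  by rewrite /D /g wE; exact: (sigma_formula a0 b0 n0 q0 cop).
have haE : h_a w = (\sum_(0 <= j < n) ext alpha j)%N by rewrite wE h_a_blocks.
have hbE : h_b w = (\sum_(0 <= j < n) ext beta j)%N by rewrite wE h_b_blocks.
have haR : 0 < (h_a w)%:R :> R by rewrite ltr0n.
have gR : 0 < g%:R :> R by rewrite ltr0n.
have lower : (h_b w * g <= D * h_a w)%N.
  have := @sum_demand_ge (ext alpha) (ext beta) a0 n g; rewrite -haE -hbE -/D; apply; exact: dvdn_gcdr.
rewrite sE; split.
- apply/andP; split.
    by rewrite ler_pdivrMr // mulrAC ler_pdivlMr // -!natrM ler_nat.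
  rewrite ler_pdivrMr // -natrM ler_nat maxE mulnC.
  exact: sum_demand_le_max.
- move=> hq; have gE : g = h_a w by apply/gcdn_idPr.
  rewrite gE; congr (_%:R / _); apply/eqP; rewrite eqn_leq.
  rewrite {1}hbE sum_demand_le //=.
  by move: lower; rewrite gE leq_mul2r eqn0Ngt ha0.
- move=> g1; rewrite maxE /D /g g1 divr1; congr (_%:R).
  exact: sum_demand1.
Qed.
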